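(* For all $n\ge 5$, $\mathrm{r}_n(1432)=2\,\mathrm{r}_{n-1}(1432)+\mathrm{r}_{n-2}(1432)$.
   Context: $\mathcal{S}_n$ is the set of permutations of $[n]$, $\pi^r$ the reversal of $\pi$. A word $w$ contains $\rho\in\mathcal{S}_k$ if some subsequence $w_{i_1}\cdots w_{i_k}$ ($i_1<\cdots<i_k$) satisfies $w_{i_a}\le w_{i_b}$ iff $\rho_a\le\rho_b$; otherwise it avoids $\rho$. $\mathcal{R}_n=\{\pi\pi^r:\pi\in\mathcal{S}_n\}$ (concatenation of $\pi$ with its reversal), and $\mathrm{r}_n(\rho)$ is the number of members of $\mathcal{R}_n$ avoiding $\rho$. *)

(* Defs.v *)
From mathcomp Require Import all_boot.

Set Implicit Arguments.
Unset Strict Implicit.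
Unset Printing Implicit Defensive.

(* Words over the positive integers are [seq nat]; a permutation of
   {1, ..., n} is given in one-line notation. Positions are 0-based, letters
   are 1-based. *)
Definition perms (n : nat) : seq (seq nat) := permutations (iota 1 n).

Definition contains (w rho : seq nat) : bool :=
  [exists i : {ffun 'I_(size rho) -> 'I_(size w)},
    [forall a : 'I_(size rho), forall b : 'I_(size rho),
      (a < b) ==> (i a < i b)] &&
    [forall a : 'I_(size rho), forall b : 'I_(size rho),
      (nth 0 w (i a) <= nth 0 w (i b)) == (nth 0 rho a <= nth 0 rho b)]].

Definition avoids (w rho : seq nat) : bool := ~~ contains w rho.

(* [undup] makes this a list without repetition, so that it stands for a set
   of words. *)
Definition Rwords (n : nat) : seq (seq nat) :=
  undup [seq p ++ rev p | p <- perms n].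

Definition r (n : nat) (rho : seq nat) : nat :=
  size [seq w <- Rwords n | avoids w rho].

(* Main.v *)
Require Import Defs.
From mathcomp Require Import all_boot zify.

(** Write w = p ++ rev p. A copy of 1432 in w using the first letter x of p
    must use it as the 1 (first letter of w) or as the 2 (last letter of w).
    Hence in a good permutation of [n] (one for which w avoids 1432) the two
    largest letters may stand first without any constraint on the rest, the
    letter n - 2 may stand first exactly when it is followed by n, and then the
    rest is again unconstrained, and (for n >= 5) no smaller letter may stand
    first. *)

(** * Good permutations and copies of 1432 as subsequences *)

Definition good (p : seq nat) : bool := avoids (p ++ rev p) [:: 1; 4; 3; 2].

Definition count_good (s : seq nat) : nat := count good (permutations s).

(** Reversal turns this into the defining equation of [subseq] on [cons]. It serves to compare the
    last letter of a copy with the last letter of a word. *)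
Lemma subseq_rconsE (T : eqType) (q s : seq T) (b x : T) :
  subseq (rcons q b) (rcons s x) =
    if b == x then subseq q s else subseq (rcons q b) s.
Proof.
rewrite -[LHS]subseq_rev -[subseq q s]subseq_rev -[subseq (rcons q b) s]subseq_rev.
by rewrite !rev_rcons /=; case: eqP.
Qed.

(** Trades the position function for a subsequence [q], on which one can compute by recursion. *)
Lemma containsP (w rho : seq nat) :
  reflect (exists2 q, subseq q w & size q = size rho /\
             forall i j, i < size rho -> j < size rho ->
               (nth 0 q i <= nth 0 q j) = (nth 0 rho i <= nth 0 rho j))
          (contains w rho).
Proof.
apply: (iffP existsP) => [[f /andP[/forallP mono /forallP ord]]|[q sub [sz ord]]].
- pose js := [seq (f a : nat) | a <- enum 'I_(size rho)].
  have szjs : size js = size rho by rewrite size_map size_enum_ord.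
  have js_sorted : sorted ltn js.
    rewrite sorted_map.
    apply: (@sub_sorted _ (relpre val ltn)).
      by move=> a b /= ab; move/forallP: (mono a) => /(_ b) /implyP; apply.
    by rewrite -sorted_map val_enum_ord iota_ltn_sorted.
  have js_sub : subseq js (iota 0 (size w)).
    suff -> : js = [seq k <- iota 0 (size w) | k \in js] by exact: filter_subseq.
    (* Both sides are strictly increasing lists with the same members. *)
    apply: (irr_sorted_eq ltn_trans ltnn) => //.
      by apply: sorted_filter (iota_ltn_sorted _ _); exact: ltn_trans.
    move=> k; rewrite mem_filter mem_iota add0n /=.
    by case: (boolP (k \in js)) => //= /mapP[a _ ->]; rewrite ltn_ord.
  exists [seq nth 0 w k | k <- js].
    by have := map_subseq (nth 0 w) js_sub; rewrite map_nth_iota0 // take_size.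
  split; first by rewrite size_map.
  move=> i j hi hj.
  rewrite !(nth_map 0) ?szjs //.
  have js_nth k (hk : k < size rho) : nth 0 js k = f (Ordinal hk).
    rewrite (nth_map (Ordinal hk)) ?size_enum_ord //; congr (nat_of_ord (f _)).
    by apply: val_inj; rewrite /= nth_enum_ord.
  rewrite (js_nth i hi) (js_nth j hj).
  by move/forallP: (ord (Ordinal hi)) => /(_ (Ordinal hj)) /eqP.
- have [m szm def_q] := subseqP sub.
  (* The mask that cuts [q] out of [w], applied to the list of all positions, gives the positions of
     the copy. *)
  pose js := mask m (iota 0 (size w)).
  have q_js : q = [seq nth 0 w k | k <- js].
    by rewrite def_q /js map_mask map_nth_iota0 // take_size.
  have szjs : size js = size rho by rewrite -sz q_js size_map.
  have js_sorted : sorted ltn js.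
    by apply: sorted_mask (iota_ltn_sorted _ _); exact: ltn_trans.
  have js_lt (a : 'I_(size rho)) : nth 0 js a < size w.
    have : nth 0 js a \in js by rewrite mem_nth // szjs.
    by move/mem_mask; rewrite mem_iota.
  exists [ffun a => Ordinal (js_lt a)]; apply/andP; split.
    apply/forallP=> a; apply/forallP=> b; apply/implyP=> ab; rewrite !ffunE /=.
    by apply: (sorted_ltn_nth ltn_trans) => //; rewrite inE szjs.
  apply/forallP=> a; apply/forallP=> b; rewrite !ffunE /=; apply/eqP.
  by rewrite -ord // q_js !(nth_map 0) ?szjs.
Qed.

(** The letters are named in order of value, hence occur in the word as a, d, c, b. *)
Lemma contains1432P (w : seq nat) :
  reflect (exists a b c d, [/\ a < b, b < c, c < d & subseq [:: a; d; c; b] w])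
          (contains w [:: 1; 4; 3; 2]).
Proof.
apply: (iffP (containsP _ _)) => [[q sub [sz ord]]|[a [b [c [d [ab bc cd sub]]]]]].
- case: q sz ord sub => [|a [|d [|c [|b [|? ?]]]]] // _ ord sub.
  exists a, b, c, d; split => //.
  + by have := ord 3 0 isT isT; rewrite /= leqNgt => /negbFE.
  + by have := ord 2 3 isT isT; rewrite /= leqNgt => /negbFE.
  + by have := ord 1 2 isT isT; rewrite /= leqNgt => /negbFE.
- exists [:: a; d; c; b] => //; split => // i j.
  by case: i => [|[|[|[|i]]]] //; case: j => [|[|[|[|j]]]] //= _ _; lia.
Qed.

Lemma contains_map (f : nat -> nat) (w rho : seq nat) :
  {mono f : i j / i <= j} -> contains [seq f i | i <- w] rho = contains w rho.
Proof.
move=> fM; apply/containsP/containsP => [[q sub [sz ord]]|[q sub [sz ord]]].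
- have [m szm def_q] := subseqP sub; rewrite size_map in szm.
  exists (mask m w); first exact: mask_subseq.
  rewrite -map_mask in def_q.
  have sz' : size (mask m w) = size rho by rewrite -sz def_q size_map.
  split=> // i j hi hj.
  by rewrite -ord // def_q !(nth_map 0) ?sz' // fM.
- exists [seq f i | i <- q]; first exact: map_subseq.
  split=> [|i j hi hj]; first by rewrite size_map.
  by rewrite !(nth_map 0) ?sz // fM ord.
Qed.

Lemma good_map (f : nat -> nat) (p : seq nat) :
  {mono f : i j / i <= j} -> good [seq f i | i <- p] = good p.
Proof. by move=> fM; rewrite /good /avoids -map_rev -map_cat contains_map. Qed.

(** * Putting a letter in front of a good word *)

(** Since [x] is not in [t], it stands only at the two ends of the word, and a copy, having distinct
    letters, uses at most one of them: the first as its 1 (second condition) or the last as its 2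
    (third condition). *)
Lemma good_consP {x : nat} {t : seq nat} : x \notin t ->
  reflect [/\ good t,
             forall b c d, x < b -> b < c -> c < d -> 
               ~~ subseq [:: d; c; b] (t ++ rev t) &
             forall a c d, a < x -> x < c -> c < d -> 
               ~~ subseq [:: a; d; c] (t ++ rev t)]
          (good (x :: t)).
Proof.
move=> xt; rewrite /good /avoids rev_cons cat_cons -rcons_cat.
set s := t ++ rev t.
have xs : x \notin s by rewrite mem_cat mem_rev orbb.
apply: (iffP idP) => [/contains1432P no|[/contains1432P no no1 no2]].
- split.
  + apply/contains1432P => -[a [b [c [d [ab bc cd sub]]]]]; apply: no.
    exists a, b, c, d; split=> //.
    exact: subseq_trans (subseq_trans sub (subseq_rcons s x)) (subseq_cons _ x).
  + move=> b c d xb bc cd; apply/negP => sub; apply: no.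
    exists x, b, c, d; split=> //; rewrite /= eqxx.
    exact: subseq_trans sub (subseq_rcons s x).
  + move=> a c d ax xc cd; apply/negP => sub; apply: no.
    exists a, x, c, d; split=> //.
    apply: subseq_trans (subseq_cons _ x).
    by rewrite -[[:: _; _; _; _]]/(rcons [:: a; d; c] x) subseq_rconsE eqxx.
- apply/contains1432P => -[a [b [c [d [ab bc cd]]]]] /=.
  have [ax|ax] := eqVneq a x.
    rewrite ax in ab.
    rewrite -[[:: _; _; _]]/(rcons [:: d; c] b) subseq_rconsE.
    rewrite gtn_eqF //= => sub.
    by have := no1 b c d ab bc cd; rewrite sub.
  rewrite -[[:: _; _; _; _]]/(rcons [:: a; d; c] b) subseq_rconsE.
  have [bx|bx] := eqVneq b x => sub.
    by rewrite bx in ab bc; have := no2 a c d ab bc cd; rewrite sub.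
  by apply: no; exists a, b, c, d.
Qed.

(** [a] is taken from the first half and [b] from the mirrored one, whatever their order in [u]. *)
Lemma subseq_palindrome (T : eqType) (a b : T) (u : seq T) :
  a \in u -> b \in u -> subseq [:: a; b] (u ++ rev u).
Proof.
move=> au bu; rewrite -[[:: a; b]]/([:: a] ++ [:: b]).
by apply: cat_subseq; rewrite sub1seq ?mem_rev.
Qed.

(** A copy with [x] as its 1 or its 2 needs two larger letters of [t] as its 3 and its 4. *)
Lemma good_cons_large {x : nat} {t : seq nat} : x \notin t ->
  (forall c d, c \in t -> d \in t -> x < c -> ~~ (c < d)) -> good (x :: t) = good t.
Proof.
move=> xt few; apply/idP/idP => [/(good_consP xt)[]//|gt]; apply/(good_consP xt).
have mem_t y q : subseq q (t ++ rev t) -> y \in q -> y \in t.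
  by move=> /mem_subseq sub /sub; rewrite mem_cat mem_rev orbb.
split=> // [b c d xb bc cd|a c d ax xc cd]; apply/negP => sub;
  have := few c d; rewrite cd !(mem_t _ _ sub) ?inE ?eqxx ?orbT //;
  by move=> /(_ isT isT); case: ltnP => //; lia.
Qed.

(** Being largest, [m] could only be the 4 of a copy through [x]. If [x] is the 1, the 3 and the 2
    would still be two letters of [u] above [x]. If [x] is the 2, the 4 lies between the 1 and the
    3, whereas [m] stands only at the ends of [m :: rcons (u ++ rev u) m]. *)
Lemma good_cons_third (x m : nat) (u : seq nat) : uniq [:: x, m & u] -> x < m ->
  (forall c, c \in u -> c < m) ->
  (forall c d, c \in u -> d \in u -> x < c -> ~~ (c < d)) ->
  good [:: x, m & u] = good u.
Proof.
move=> /= /and3P[xmu mu _] xm u_lt few.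
(* By maximality [m] may be put back in front of [u], so only copies through [x] remain to be
   excluded. *)
rewrite -[RHS](good_cons_large mu); last first.
  by move=> c d /u_lt cm _ mc; have := ltn_trans mc cm; rewrite ltnn.
have mem_u y q : subseq q (u ++ rev u) -> y \in q -> y \in u.
  by move=> /mem_subseq sub /sub; rewrite mem_cat mem_rev orbb.
have muE : (m :: u) ++ rev (m :: u) = m :: rcons (u ++ rev u) m.
  by rewrite rev_cons cat_cons rcons_cat.
apply/idP/idP => [/(good_consP xmu)[]//|gt]; apply/(good_consP xmu).
split=> // [b c d xb bc cd|a c d ax xc cd]; apply/negP; rewrite muE /=.
(* The front [m] is matched with [d] or skipped, leaving c b or d c b; either list is folded into
   [rcons] form to test [b] against the final [m]. *)
- case: (eqVneq d m) => dm;
    rewrite -1?[[:: d; c; b]]/(rcons [:: d; c] b) -1?[[:: c; b]]/(rcons [:: c] b) subseq_rconsE;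
    case: (eqVneq b m) => bm sub; try lia.
  + by have := few b c; rewrite bc !(mem_u _ _ sub) ?inE ?eqxx ?orbT // => /(_ isT isT xb).
  + have := mem_u c _ sub; rewrite ?inE ?eqxx ?orbT // => /(_ isT) /u_lt; lia.
  + by have := few b c; rewrite bc !(mem_u _ _ sub) ?inE ?eqxx ?orbT // => /(_ isT isT xb).
- have /negPf -> : a != m by lia.
  rewrite -[[:: a; d; c]]/(rcons [:: a; d] c) subseq_rconsE.
  case: (eqVneq c m) => [cm|cm] sub.
  + have := mem_u d _ sub; rewrite ?inE ?eqxx ?orbT // => /(_ isT) /u_lt; lia.
  + by have := few c d; rewrite cd !(mem_u _ _ sub) ?inE ?eqxx ?orbT // => /(_ isT isT xc).
Qed.

(** * First pairs x, y that force a copy of 1432 in the word x y u u^r y x *)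

Section BadHeads.
Variables (x y : nat) (u : seq nat).
Hypothesis xyu : x \notin y :: u.

Let cat_yu : (y :: u) ++ rev (y :: u) = y :: rcons (u ++ rev u) y.
Proof. by rewrite rev_cons cat_cons rcons_cat. Qed.

(** The copy is x y c b, with the front [y] as its 4. *)
Lemma bad_head_max (b c : nat) :
  b \in u -> c \in u -> x < b -> b < c -> c < y -> ~~ good (x :: y :: u).
Proof.
move=> bu cu xb bc cy; apply/(good_consP xyu) => -[_ /(_ b c y xb bc cy) /negP + _]; apply.
rewrite cat_yu /= eqxx; apply: subseq_trans (subseq_rcons _ _).
exact: subseq_palindrome.
Qed.

(** The copy is x d c y, with the final [y] as its 2. *)
Lemma bad_head_min (c d : nat) :
  c \in u -> d \in u -> x < y -> y < c -> c < d -> ~~ good (x :: y :: u).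
Proof.
move=> cu du xy yc cd; apply/(good_consP xyu) => -[_ /(_ y c d xy yc cd) /negP + _]; apply.
rewrite cat_yu; apply: subseq_trans (subseq_cons _ _).
rewrite -[[:: _; _; _]]/(rcons [:: d; c] y) subseq_rconsE eqxx.
exact: subseq_palindrome.
Qed.

(** The copy is y d c x, from the front [y] to the final [x]. *)
Lemma bad_head_small (c d : nat) :
  c \in u -> d \in u -> y < x -> x < c -> c < d -> ~~ good (x :: y :: u).
Proof.
move=> cu du yx xc cd; apply/(good_consP xyu) => -[_ _ /(_ y c d yx xc cd) /negP +]; apply.
rewrite cat_yu /= eqxx; apply: subseq_trans (subseq_rcons _ _).
exact: subseq_palindrome.
Qed.

(** The copy is a d y x, ending with the last two letters of the word. *)
Lemma bad_head_mid (a d : nat) :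
  a \in u -> d \in u -> a < x -> x < y -> y < d -> ~~ good (x :: y :: u).
Proof.
move=> au du ax xy yd; apply/(good_consP xyu) => -[_ _ /(_ a y d ax xy yd) /negP +]; apply.
rewrite cat_yu; apply: subseq_trans (subseq_cons _ _).
rewrite -[[:: _; _; _]]/(rcons [:: a; d] y) subseq_rconsE eqxx.
exact: subseq_palindrome.
Qed.

End BadHeads.

(** * Counting good arrangements of an alphabet *)

(** The word [p ++ rev p] determines its first half [p], so [undup] removes nothing. *)
Lemma r_count_good (n : nat) : r n [:: 1; 4; 3; 2] = count_good (iota 1 n).
Proof.
rewrite /r /Rwords undup_id ?map_inj_uniq ?permutations_uniq //.
  by rewrite size_filter count_map.
move=> p q /eqP pq.
have sz : size p = size q.
  by have := congr1 size (eqP pq); rewrite !size_cat !size_rev !addnn => /double_inj.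
by move: pq; rewrite eqseq_cat // => /andP[/eqP].
Qed.

Lemma perm_count_good (s t : seq nat) : perm_eq s t -> count_good s = count_good t.
Proof. by move=> st; apply/permP/perm_permutations. Qed.

Lemma count_good_map (f : nat -> nat) (s : seq nat) :
  {mono f : i j / i <= j} -> count_good [seq f i | i <- s] = count_good s.
Proof.
move=> fM; have f_inj : injective f by exact: incn_inj.
rewrite /count_good.
have /permP -> : perm_eq (permutations [seq f i | i <- s])
                         [seq [seq f i | i <- t] | t <- permutations s].
  apply: uniq_perm; rewrite ?permutations_uniq ?map_inj_uniq ?permutations_uniq //.
    exact: inj_map.
  move=> t; rewrite mem_permutations; apply/idP/mapP => [tp|[t0 + ->]].
  (* A rearrangement of the image is a rearrangement [ks] of indices, which can be applied to [s]
     instead. *)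
  - have [ks ks_perm ->] := perm_iotaP 0 tp; rewrite size_map in ks_perm.
    exists [seq nth 0 s k | k <- ks].
      by rewrite mem_permutations; apply/(perm_iotaP 0); exists ks.
    rewrite -map_comp; apply/eq_in_map => k.
    by rewrite (perm_mem ks_perm) mem_iota /= => ks_lt; rewrite (nth_map 0).
  - by rewrite mem_permutations; exact: perm_map.
by rewrite count_map; apply: eq_count => t; rewrite /= good_map.
Qed.

Lemma count_permutations_cons (T : eqType) (P : pred (seq T)) (s : seq T) :
  0 < size s -> uniq s ->
  count P (permutations s) =
    \sum_(x <- s) count (fun t => P (x :: t)) (permutations (rem x s)).
Proof.
move=> s0 us; rewrite (permP (permutationsE s0)) undup_id //.
rewrite count_flatten -map_comp sumnE big_map.
by apply: eq_bigr => x _; rewrite /= count_map.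
Qed.

(** [bump h] is the increasing map that skips the value [h]; this handles the alphabet left after
    removing a head [h]. *)
Lemma count_good_bump (s : seq nat) (n h : nat) :
  perm_eq s [seq bump h i | i <- iota 1 n] -> count_good s = r n [:: 1; 4; 3; 2].
Proof.
move=> /perm_count_good ->; rewrite count_good_map ?r_count_good //.
exact: leq_bump2.
Qed.

Lemma mem_map_bump (h n k : nat) :
  (k \in [seq bump h i | i <- iota 1 n]) = [&& k != h, 0 < unbump h k & unbump h k <= n].
Proof.
apply/mapP/and3P => [[i + ->]|[kh k0 kn]].
  by rewrite mem_iota bumpK add1n ltnS => /andP[-> ->]; rewrite eq_sym neq_bump.
by exists (unbump h k); rewrite ?unbumpK // mem_iota add1n ltnS k0.
Qed.

(** * The recurrence, by the first letter *)

Theorem theorem13 (n : nat) (hn : 5 <= n) :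
  r n [:: 1; 4; 3; 2] =
    2 * r (n - 1) [:: 1; 4; 3; 2] + r (n - 2) [:: 1; 4; 3; 2].
Proof.
(* With n = m + 3, the bound n >= 5 becomes m >= 2. *)
case: n hn => [|[|[|m]]] // m2; rewrite !ltnS in m2.
rewrite !subSS !subn0.
have iota_m : uniq (iota 1 m) by exact: iota_uniq.
(* The three largest letters are listed first, so that [big_cons] splits them off and leaves the sum
   over the heads 1, ..., m. *)
set s := [:: m.+3, m.+2, m.+1 & iota 1 m].
have us : uniq s by rewrite /= !inE !mem_iota iota_m; lia.
have -> : r m.+3 [:: 1; 4; 3; 2] = count_good s.
  rewrite r_count_good; apply/perm_count_good/uniq_perm; rewrite ?iota_uniq //.
  by move=> k; rewrite !inE !mem_iota; lia.
rewrite /count_good count_permutations_cons // !big_cons.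
have rem3 : rem m.+3 s = [:: m.+2, m.+1 & iota 1 m] by rewrite /= eqxx.
have rem2 : rem m.+2 s = [:: m.+3, m.+1 & iota 1 m] by rewrite /= eqxx; case: eqP => //; lia.
have rem1 : rem m.+1 s = [:: m.+3, m.+2 & iota 1 m].
  by rewrite /=; do !case: eqP => //; lia.
have perm_mem_s x t : x \in s -> t \in permutations (rem x s) ->
    perm_eq (x :: t) s.
  move=> xs; rewrite mem_permutations -(perm_cons x) => /perm_trans; apply.
  by rewrite perm_sym perm_to_rem.
(* This places in [u] the witnesses that the bad-head lemmas ask for. *)
have second x y u : perm_eq [:: x, y & u] s ->
    [/\ x \notin y :: u, x != y, 0 < y <= m.+3 &
       forall k, k != x -> k != y -> 0 < k <= m.+3 -> k \in u].
  move=> ts; have /andP[xyu _] : uniq [:: x, y & u] by rewrite (perm_uniq ts).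
  have xy : x != y by move: xyu; rewrite inE negb_or => /andP[].
  split=> // [|k /negPf kx /negPf ky k_le].
    have : y \in s by rewrite -(perm_mem ts) !inE eqxx orbT.
    by rewrite !inE mem_iota; lia.
  by have := perm_mem ts k; rewrite !inE kx ky mem_iota /= => ->; lia.
have -> : count (fun t => good (m.+3 :: t)) (permutations (rem m.+3 s)) =
          r m.+2 [:: 1; 4; 3; 2].
  rewrite -(@count_good_bump (rem m.+3 s) m.+2 m.+3); last first.
    apply: uniq_perm; rewrite ?rem_uniq ?(map_inj_uniq (can_inj (bumpK _))) ?iota_uniq //.
    by move=> k; rewrite rem3 mem_map_bump /unbump !inE mem_iota; lia.
  apply: eq_in_count => t /(perm_mem_s _ _ (mem_head _ _)) ts.
  have /andP[mt _] : uniq (m.+3 :: t) by rewrite (perm_uniq ts).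
  apply: good_cons_large => // c d ct _ mc.
  have : c \in s by rewrite -(perm_mem ts) inE ct orbT.
  by rewrite !inE mem_iota; lia.
have -> : count (fun t => good (m.+2 :: t)) (permutations (rem m.+2 s)) =
          r m.+2 [:: 1; 4; 3; 2].
  rewrite -(@count_good_bump (rem m.+2 s) m.+2 m.+2); last first.
    apply: uniq_perm; rewrite ?rem_uniq ?(map_inj_uniq (can_inj (bumpK _))) ?iota_uniq //.
    by move=> k; rewrite rem2 mem_map_bump /unbump !inE mem_iota; lia.
  apply: eq_in_count => t /perm_mem_s; rewrite !inE eqxx orbT => /(_ isT) ts.
  have /andP[mt _] : uniq (m.+2 :: t) by rewrite (perm_uniq ts).
  apply: good_cons_large => // c d ct dt mc.
  have : c \in s by rewrite -(perm_mem ts) inE ct orbT.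
  have : d \in s by rewrite -(perm_mem ts) inE dt orbT.
  by rewrite !inE !mem_iota; lia.
have -> : count (fun t => good (m.+1 :: t)) (permutations (rem m.+1 s)) =
          r m.+1 [:: 1; 4; 3; 2].
  rewrite -(@count_good_bump (m.+2 :: iota 1 m) m.+1 m.+1); last first.
    apply: uniq_perm; rewrite ?(map_inj_uniq (can_inj (bumpK _))) ?iota_uniq //.
      by rewrite /= mem_iota iota_m; lia.
    by move=> k; rewrite mem_map_bump /unbump !inE mem_iota; lia.
  have ms : m.+1 \in s by rewrite !inE eqxx !orbT.
  (* The second letter is singled out: m + 3 leaves the rest free to be any good arrangement, and
     every other choice contributes 0. *)
  rewrite count_permutations_cons ?rem_uniq //; last by rewrite rem1.
  rewrite rem1 big_cons [rem m.+3 _]/= eqxx big1_seq ?addn0 => [|y /= ys].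
    apply: eq_in_count => u; rewrite mem_permutations => us_perm.
    have u_mem c : c \in u -> (c == m.+2) || (0 < c <= m).
      by rewrite (perm_mem us_perm) inE mem_iota add1n ltnS.
    apply: good_cons_third => //.
    - by rewrite /= !inE (perm_uniq us_perm) !(perm_mem us_perm) !inE !mem_iota /= mem_iota iota_m; lia.
    - by move=> c /u_mem; lia.
    - by move=> c d /u_mem + /u_mem; lia.
  apply/eqP; rewrite eqn0Ngt -has_count -all_predC; apply/allP => u up /=.
  have tp : y :: u \in permutations (rem m.+1 s).
    rewrite rem1 mem_permutations; move: up; rewrite mem_permutations => up.
    have y_rem : y \in [:: m.+3, m.+2 & iota 1 m] by rewrite inE ys orbT.
    by rewrite perm_sym (perm_trans (perm_to_rem y_rem)) // perm_cons perm_sym.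
  have [xyu xy y_le mem_u] := second _ _ _ (perm_mem_s _ _ ms tp).
  have {}ys : (y == m.+2) || (0 < y <= m) by move: ys; rewrite inE mem_iota add1n ltnS.
  (* The copies are 1, m+3, m+2, m+1 if y = m + 2, and y, m+3, m+2, m+1 otherwise. *)
  have [y_eq|y_ne] := eqVneq y m.+2.
    by apply: (bad_head_mid _ _ _ xyu 1 m.+3); try apply: mem_u; lia.
  by apply: (bad_head_small _ _ _ xyu m.+2 m.+3); try apply: mem_u; lia.
(* Heads x <= m contribute 0, since every second letter [y] yields a copy. *)
rewrite big1_seq ?addn0 ?mul2n -?addnn ?addnA // => x /=.
rewrite mem_iota => x_lt; apply/eqP; rewrite eqn0Ngt -has_count -all_predC.
apply/allP => t tp /=.
have xs : x \in s by rewrite !inE mem_iota x_lt !orbT.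
have ts := perm_mem_s _ _ xs tp.
case: t ts {tp} => [|y u] ts; first by have := perm_size ts.
have [xyu xy y_le mem_u] := second _ _ _ ts.
have [y_eq|y3] := eqVneq y m.+3.
  by apply: (bad_head_max _ _ _ xyu m.+1 m.+2); try apply: mem_u; lia.
have [y_eq|y2] := eqVneq y m.+2.
  have [x_eq|x1] := eqVneq x 1.
    (* The copy 1, m+2, m+1, 2 requires 2 < m + 1, which is the bound m >= 2. *)
    by apply: (bad_head_max _ _ _ xyu 2 m.+1); try apply: mem_u; lia.
  by apply: (bad_head_mid _ _ _ xyu 1 m.+3); try apply: mem_u; lia.
(* Now y <= m + 1, so m + 2 and m + 3 both lie in [u] and exceed [x] and [y]. *)
have [yx|yx] := ltnP y x.
  by apply: (bad_head_small _ _ _ xyu m.+2 m.+3); try apply: mem_u; lia.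
by apply: (bad_head_min _ _ _ xyu m.+2 m.+3); try apply: mem_u; lia.
Qed.
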